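(* Let $A=\sigma(R)\langle x_1,\dots,x_n\rangle$ be a semicommutative skew PBW extension of an integral domain $R$, with parameters $c_{i,j}\in R\setminus\{0\}$ given by $x_jx_i=c_{i,j}x_ix_j$. Then $A$ is a PI-ring if and only if for all $1\le i<j\le n$ the coefficients $c_{i,j}$ are roots of unity.
   Context: A ring $A$ is a PI-ring (satisfies the PI property) if there is a polynomial $f\in\mathbb{Z}\langle X_1,\dots,X_m\rangle$ in noncommuting variables which is monic (at least one of the monomials of highest total degree appearing in $f$ has coefficient $1$) and such that $f(a_1,\dots,a_m)=0$ for all $a_1,\dots,a_m\in A$. Skew PBW extension: let $R\subseteq A$ be rings. $A$ is a skew PBW extension of $R$, written $A=\sigma(R)\langle x_1,\dots,x_n\rangle$, if (i) $R$ is a subring of $A$; (ii) there are $x_1,\dots,x_n\in A$ such that $A$ is a free left $R$-module with basis $\{x_1^{\alpha_1}\cdots x_n^{\alpha_n}\mid \alpha\in\mathbb{N}^n\}$; (iii) for every $1\le i\le n$ and $r\in R\setminus\{0\}$ there is $c_{i,r}\in R\setminus\{0\}$ with $x_ir-c_{i,r}x_i\in R$; (iv) for every $1\le i,j\le n$ there is $c_{i,j}\in R\setminus\{0\}$ with $x_jx_i-c_{i,j}x_ix_j\in R+Rx_1+\cdots+Rx_n$. Then for each $i$ there are an injective ring endomorphism $\sigma_i$ of $R$ and a $\sigma_i$-derivation $\delta_i$ of $R$ with $x_ir=\sigma_i(r)x_i+\delta_i(r)$ for all $r\in R$. $A$ is quasi-commutative if (iii) and (iv) are replaced by: for each $i$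 and $r\in R\setminus\{0\}$ there is $c_{i,r}\in R\setminus\{0\}$ with $x_ir=c_{i,r}x_i$; and for all $1\le i,j\le n$ there is $c_{i,j}\in R\setminus\{0\}$ with $x_jx_i=c_{i,j}x_ix_j$. $A$ is constant if $\sigma_i(r)=r$ and $\delta_i(r)=0$ for all $i$ and all $r\in R$. $A$ is semicommutative if it is both quasi-commutative and constant. *)

(* Defs.v *)
From HB Require Import structures.
From mathcomp Require Import all_boot all_algebra.
From mathcomp Require Import finmap.
From mathcomp.multinomials Require Import monalg.

Set Implicit Arguments.
Unset Strict Implicit.
Unset Printing Implicit Defensive.

Import GRing.Theory.
Local Open Scope ring_scope.

(* Z<X_0, ..., X_(m-1)> is the algebra over int of the free monoid on 'I_m,
   whose elements are words, i.e. sequences over 'I_m. *)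
Notation ncpoly m := {malg int[{fmonom 'I_m}]}.

Definition nceval (A : nzRingType) (m : nat) (a : 'I_m -> A) (f : ncpoly m)
  : A :=
  mmap (fun z : int => z%:~R : A)
       (fun w : {fmonom 'I_m} => \prod_(i <- (w : seq 'I_m)) a i) f.

(* Not monic with respect to a fixed monomial order: some word of maximal
   degree has coefficient 1, others of the same degree are unconstrained. *)
Definition ncmonic (m : nat) (f : ncpoly m) : Prop :=
  exists2 w : {fmonom 'I_m}, mcoeff w f = 1 &
    forall v : {fmonom 'I_m}, v \in msupp f -> (fdeg v <= fdeg w)%N.

Definition PI_ring (A : nzRingType) : Prop :=
  exists (m : nat) (f : ncpoly m),
    ncmonic f /\ forall a : 'I_m -> A, nceval a f = 0.

(* m.-unity_root is also true of every element for m = 0, hence the bound. *)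
Definition is_unity_root (R : nzRingType) (q : R) : Prop :=
  exists2 m : nat, (0 < m)%N & m.-unity_root q.

(* The inclusion of the subring R in A is an injective morphism iota; the left
   R-module structure of A is then r . a := iota r * a. *)
Section SkewPBW.
Variables (R A : nzRingType) (iota : {rmorphism R -> A}).
Variables (n : nat) (x : 'I_n -> A).

(* The product is taken in increasing order of the indices. *)
Definition std_mon (al : {ffun 'I_n -> nat}) : A := \prod_(i < n) x i ^+ al i.

(* The left linear combination of the standard monomials with coefficients the
   finitely supported family p. *)
Definition std_comb (p : {malg R[{ffun 'I_n -> nat}]}) : A :=
  mmap iota std_mon p.

Definition std_basis : Prop :=
  (forall a : A, exists p, a = std_comb p) /\
  (forall p, std_comb p = 0 -> p = 0).

Definition skew_PBW : Prop :=
  [/\ injective iota,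
      std_basis,
      forall (i : 'I_n) (r : R), r != 0 ->
        exists2 c : R, c != 0 &
          exists s : R, x i * iota r - iota c * x i = iota s
    & forall i j : 'I_n,
        exists2 c : R, c != 0 &
          exists (s : R) (t : 'I_n -> R),
            x j * x i - iota c * x i * x j
            = iota s + \sum_(k < n) iota (t k) * x k].

Definition quasi_commutative : Prop :=
  [/\ injective iota,
      std_basis,
      forall (i : 'I_n) (r : R), r != 0 ->
        exists2 c : R, c != 0 & x i * iota r = iota c * x i
    & forall i j : 'I_n,
        exists2 c : R, c != 0 & x j * x i = iota c * x i * x j].

Definition skew_derivation (sigma delta : R -> R) : Prop :=
  forall r s, delta (r * s) = sigma r * delta s + delta r * s.

(* By freeness at most one pair (sigma, delta) of families satisfies this. *)
Definition structure_maps (sigma : 'I_n -> {rmorphism R -> R})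
    (delta : 'I_n -> {additive R -> R}) : Prop :=
  forall i : 'I_n,
    [/\ injective (sigma i),
        skew_derivation (sigma i) (delta i)
      & forall r, x i * iota r = iota (sigma i r) * x i + iota (delta i r)].

Definition constant_PBW : Prop :=
  exists (sigma : 'I_n -> {rmorphism R -> R})
         (delta : 'I_n -> {additive R -> R}),
    structure_maps sigma delta /\
    forall i r, sigma i r = r /\ delta i r = 0.

Definition semicommutative : Prop := quasi_commutative /\ constant_PBW.

End SkewPBW.

(* Main.v *)
Require Import Defs.
From HB Require Import structures.
From mathcomp Require Import all_boot all_algebra all_fingroup.
From mathcomp Require Import zify.
From mathcomp Require Import finmap.
From mathcomp.multinomials Require Import monalg.

Set Implicit Arguments.
Unset Strict Implicit.
Unset Printing Implicit Defensive.

Import GRing.Theory.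
Local Open Scope ring_scope.

(** Since the extension is constant, R is central in A, and the relations
    x_j x_i = c_ij x_i x_j say that standard monomials multiply up to scalars:
    x^al * x^be = twist al be * x^(al + be), where twist is the product of the
    c_kl ^ (al_l be_k) over k < l ([std_monM]).  Hence any product of terms
    r * x^al is again a term, with an explicit coefficient ([prod_terms]).
    Both implications are read off this coefficient.

    If all c_kl have a common exponent N, then twist only depends on the
    exponents modulo N.  Among more than N^n terms two have congruent
    exponents; exchanging them in any product leaves the product unchanged, so
    the alternating sum over all permutations vanishes
    ([standard_terms_eq0]).  By multilinearity the standard polynomial of
    degree N^n + 1, which is monic, is an identity of A ([standard_eq0]).

    Conversely let f be an identity of A with coefficient 1 at a word w0 of
    degree d, and let q = c_ij with i < j.  For N > 0, replace each variable k
    by the sum, over the positions p < d where w0 has the letter k, of the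
    probes q^(N (d^2 - p^2)) x_i^(2p) x_j^N.  A word w then becomes a sum over
    the maps p sending each position h of w to a position p_h of w0 with the
    same letter, and the summand of p is q^(N e) x_i^(2 sum p_h) x_j^(N |w|)
    where e is the sum of d^2 + h^2 - (h - p_h)^2.  For |w| = d, the largest
    value of e is attained at the identity only, which forces w = w0.
    Comparing the coefficients of x_i^(d (d - 1)) x_j^(N d), one gets
    Q(q^N) = 0 for a polynomial Q that is independent of N and has a
    coefficient equal to 1 ([root_energy_poly], [energy_poly_neq0]).  As Q has
    finitely many roots in the domain R, two powers of q coincide. *)

(** * Products over increasing pairs of indices *)

Section OrderedPairs.
Variables (R : comPzRingType) (n : nat).
Implicit Types (s : seq 'I_n) (F : 'I_n -> 'I_n -> R).

Definition ord_ltn : rel 'I_n := fun i j => (i < j)%N.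

Lemma sorted_index_enum : sorted ord_ltn (index_enum 'I_n).
Proof.
rewrite [index_enum _]unlock -enumT.
have := iota_ltn_sorted 0 n; rewrite -val_enum_ord sorted_map.
by apply: sub_sorted.
Qed.

(** Both the twist of two exponents and the scalar of a product of terms are
    products over increasing pairs of indices; this peels off the least one. *)
Lemma prod_pairs_cons F k s : path ord_ltn k s ->
  \prod_(i <- k :: s) \prod_(j <- k :: s | (i < j)%N) F i j =
  (\prod_(j <- s) F k j) * \prod_(i <- s) \prod_(j <- s | (i < j)%N) F i j.
Proof.
move=> ks; have lt_ks : all (ord_ltn k) s.
  by apply: order_path_min ks; apply: ltn_trans.
rewrite big_cons big_cons ltnn; congr (_ * _).
  rewrite big_seq_cond [RHS]big_seq; apply: eq_bigl => j.
  by case: (boolP (j \in s)) => //= /(allP lt_ks).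
rewrite !big_seq; apply: eq_bigr => i /(allP lt_ks) lt_ki.
by rewrite big_cons ltnNge (ltnW lt_ki).
Qed.

End OrderedPairs.

(** * The standard polynomial *)

Definition standard_poly m : ncpoly m :=
  \sum_(s : 'S_m) << (-1) ^+ s *g FMonom (codom s) >>.

(** Distinct permutations spell distinct words, so no cancellation can affect
    the coefficient of the word of the identity permutation. *)
Lemma ncmonic_standard_poly m : ncmonic (standard_poly m).
Proof.
exists (FMonom (codom (1%g : 'S_m))) => [|v].
  rewrite /standard_poly raddf_sum (bigD1 1%g) //= mcoeffU eqxx odd_perm1.
  rewrite big1 ?addr0 // => s /eqP neq_s1; rewrite mcoeffU fmP /=.
  case: eqP => // eq_s1; case: neq_s1; apply/permP => i.
  by move/eq_in_map: eq_s1 => -> //; apply: mem_enum.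
rewrite -mcoeff_neq0 /standard_poly raddf_sum /=; apply: contraR.
rewrite -ltnNge /fdeg /= size_codom card_ord => lt_v; apply/eqP/big1 => s _.
rewrite mcoeffU fmP /=; case: eqP => // eq_v.
by move: lt_v; rewrite -eq_v size_codom card_ord ltnn.
Qed.

Lemma nceval_standard_poly (A : nzRingType) m (a : 'I_m -> A) :
  nceval a (standard_poly m) =
  \sum_(s : 'S_m) (-1) ^+ s * \prod_(i < m) a (s i).
Proof.
rewrite /nceval -[fun z : int => _]/(intr : int -> A) raddf_sum.
apply: eq_bigr => s _ /=; rewrite mmapU /= intr_sign; congr (_ * _).
by rewrite codomE big_map [index_enum _]unlock -enumT.
Qed.

(** * The energy of a map between positions of words *)

(** The left-hand side is d^2 + i^2 - (i - a)^2. *)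
Lemma dist_energy d i a : (i <= d -> a <= d ->
  (d ^ 2 - a ^ 2) + 2 * (i * a) <= (d ^ 2 - i ^ 2) + 2 * (i * i)
    ?= iff (i == a))%N.
Proof.
move=> le_id le_ad; have [AGM AGMe] := nat_Cauchy i a.
have le2 e : (e <= d)%N -> (e ^ 2 <= d ^ 2)%N by move=> ?; rewrite leq_exp2r.
have := le2 _ le_id; have := le2 _ le_ad; rewrite mulnn => le_a le_i.
split; first by lia.
by rewrite -AGMe; apply/eqP/eqP; lia.
Qed.

Definition energy d m (p : 'I_m -> nat) : nat :=
  \sum_(i < m) ((d ^ 2 - p i ^ 2) + 2 * (i * p i)).

(** The equation [m = d] cannot be built into the type of [p]: in the
    application m is the size of a word of a polynomial. *)
Lemma energy_max d m (p : 'I_m -> nat) : m = d -> (forall i, p i <= d)%N ->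
  energy d p = energy d (fun i : 'I_d => i) -> forall i, p i = i.
Proof.
move=> def_d; subst d; move=> le_p eq_p i.
have [_] := @leqif_sum _ predT (fun i => val i == p i) _ _
  (fun i _ => dist_energy (ltnW (ltn_ord i)) (le_p i)).
by rewrite [X in X = _](introT eqP eq_p) => /esym /forallP /(_ i) /eqP.
Qed.

Definition matches m (w0 w : seq 'I_m) (i : 'I_(size w)) : pred 'I_(size w0) :=
  fun p => tnth (in_tuple w0) p == tnth (in_tuple w) i.
Arguments matches {m} w0 w i p.

(** The two numerical conditions select the summands lying over the standard
    monomial produced by the identity map on the positions of w0. *)
Definition level_map m (w0 w : seq 'I_m)
    (p : {ffun 'I_(size w) -> 'I_(size w0)}) :=
  [&& p \in family (matches w0 w), size w == size w0 &
     \sum_(i < size w) p i == \sum_(i < size w0) i]%N.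
Arguments level_map {m} w0 w p.

(** Its value at q^N is the coefficient, at that standard monomial, of the
    element obtained from f by the substitution of probes. *)
Definition energy_poly (R : comNzRingType) m (f : ncpoly m) (w0 : seq 'I_m)
    : {poly R} :=
  \sum_(w <- msupp f)
     (\sum_(p | level_map w0 (w : seq 'I_m) p)
        'X^(energy (size w0) (fun i => p i))) *~ f@_w.

(** By uniqueness of the maximum, w0 and the identity map of its positions are
    the only contribution to the monomial whose degree is the energy of the
    identity. *)
Lemma energy_poly_neq0 (R : comNzRingType) m (f : ncpoly m)
    (w0 : {fmonom 'I_m}) :
  f@_w0 = 1 -> energy_poly R f w0 != 0.
Proof.
move=> f_w0; have w0_f : w0 \in msupp f by rewrite -mcoeff_neq0 f_w0.
set d := size w0.
suff: (energy_poly R f w0)`_(energy d (fun i : 'I_d => i)) = 1.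
  by move=> Qe; apply/eqP => Q0; move/eqP: Qe; rewrite Q0 coef0 eq_sym oner_eq0.
have map_id_eq (w : {fmonom 'I_m}) (p : {ffun 'I_(size w) -> 'I_d}) :
    level_map w0 w p ->
    energy d (fun i : 'I_d => i) = energy d (fun i => p i) ->
  (forall i, p i = i :> nat) /\ w = w0.
  case/and3P => /familyP p_w /eqP size_w _ eq_p.
  have p_id := energy_max size_w (fun i => ltnW (ltn_ord (p i))) (esym eq_p).
  split=> //; apply/eqP; rewrite fmP; apply/eqP.
  (* The first letter of w serves as a default value for nth. *)
  case def_w: (w : seq _) => [|k t].
    by apply/esym/size0nil; rewrite -size_w def_w.
  rewrite -def_w; apply: (@eq_from_nth _ k) => // i lt_i.
  have := p_w (Ordinal lt_i); rewrite unfold_in /= !(tnth_nth k) p_id.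
  by move/eqP->.
rewrite /energy_poly coef_sum (bigD1_seq w0) ?fset_uniq //= f_w0 mulr1z.
rewrite [X in _ + X]big1 ?addr0 => [|w neq_w].
  pose idp : {ffun 'I_(size w0) -> 'I_d} := [ffun i => i].
  rewrite coef_sum (bigD1 idp) /=; last first.
    apply/and3P; split=> //; last by apply/eqP/eq_bigr => i _; rewrite ffunE.
    by apply/familyP => i; rewrite unfold_in /= ffunE.
  rewrite big1 => [|p /andP[map_p /eqP neq_p]].
    rewrite coefXn (_ : _ == _) ?addr0 //; apply/eqP/eq_bigr => i _.
    by rewrite ffunE.
  rewrite coefXn; case: eqP => // /(map_id_eq _ _ map_p)[p_id _].
  by case: neq_p; apply/ffunP => i; rewrite ffunE; apply/val_inj/p_id.
rewrite coefMrz coef_sum big1 ?mul0rz // => p map_p; rewrite coefXn.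
case: eqP => // /(map_id_eq _ _ map_p)[_ def_w]; by rewrite def_w eqxx in neq_w.
Qed.

(** If q were not a root of unity, its powers would be infinitely many roots
    of Q. *)
Lemma root_powers_unity (R : idomainType) (Q : {poly R}) (q : R) :
  q != 0 -> Q != 0 -> (forall N, root Q (q ^+ N.+1)) -> is_unity_root q.
Proof.
move=> q_neq0 Q_neq0 rootQ.
pose rs := mkseq (fun N => q ^+ N.+1) (size Q).
have [/(max_poly_roots Q_neq0) lt_rs | ] := boolP (uniq rs).
  have : (size rs < size Q)%N.
    by apply: lt_rs; apply/allP => _ /mapP[N _ ->].
  by rewrite size_mkseq ltnn.
case/(uniqPn 0) => a [b [lt_ab]]; rewrite size_mkseq => lt_b.
rewrite !nth_mkseq ?(ltn_trans lt_ab) // => eq_ab.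
exists (b - a)%N; first by rewrite subn_gt0.
rewrite unity_rootE; apply/eqP/(mulfI (expf_neq0 a.+1 q_neq0)).
by rewrite -exprD addSn subnKC ?(ltnW lt_ab) // mulr1.
Qed.

(** * Multiplication of standard monomials *)

Section QuantumMonomials.
Variables (R : comNzRingType) (A : nzRingType) (iota : {rmorphism R -> A}).
Variables (n : nat) (x : 'I_n -> A) (c : 'I_n -> 'I_n -> R).
Hypothesis x_iota : forall i r, GRing.comm (x i) (iota r).
Hypothesis x_swap : forall i j : 'I_n, x j * x i = iota (c i j) * x i * x j.
Implicit Types (al be : {ffun 'I_n -> nat}).

Lemma exp_swap i j a b :
  x j ^+ a * x i ^+ b = iota (c i j ^+ (a * b)) * x i ^+ b * x j ^+ a.
Proof.
have swap1 e : x j * x i ^+ e = iota (c i j ^+ e) * x i ^+ e * x j.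
  elim: e => [|e IHe]; first by rewrite !expr0 rmorph1 !mul1r mulr1.
  rewrite exprSr mulrA IHe -[LHS]mulrA x_swap exprSr rmorphM.
  by rewrite -!mulrA; congr (_ * _);
    rewrite !mulrA (commrX e (commr_sym (x_iota i _))).
elim: a => [|a IHa]; first by rewrite mul0n !expr0 rmorph1 !mul1r mulr1.
rewrite exprS -mulrA IHa mulrA mulrA x_iota -[_ * x j * _]mulrA swap1.
by rewrite !mulrA -rmorphM -exprD addnC mulSn.
Qed.

Definition twist al be : R :=
  \prod_(k < n) \prod_(l < n | (k < l)%N) c k l ^+ (al l * be k).

Lemma std_mon_iota al r : GRing.comm (std_mon x al) (iota r).
Proof.
apply/commr_sym/commr_prod => i _; exact/commrX/commr_sym/x_iota.
Qed.

(** By induction on the sorted list of variables: the powers of the least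
    variable x_k of the second monomial move left past the other variables of
    the first one, which costs the factors c_kl ^ (al_l be_k). *)
Lemma std_monM al be :
  std_mon x al * std_mon x be = iota (twist al be) * std_mon x (al + be).
Proof.
rewrite /std_mon /twist.
elim: (index_enum _) (sorted_index_enum n) => [_|k s IHs ks].
  by rewrite !big_nil rmorph1 !mulr1.
rewrite prod_pairs_cons // !big_cons ffunE exprD rmorphM.
have move_k : (\prod_(l <- s) x l ^+ al l) * x k ^+ be k =
    iota (\prod_(l <- s) c k l ^+ (al l * be k))
    * x k ^+ be k * \prod_(l <- s) x l ^+ al l.
  elim: (s) => [|l t IHt]; first by rewrite !big_nil rmorph1 !mul1r mulr1.
  rewrite !big_cons -mulrA IHt mulrA [_ * (iota _ * _)]mulrA.
  rewrite -(commrX _ (commr_sym (x_iota l _))) -[_ * _ * _ ^+ be k]mulrA.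
  rewrite exp_swap.
  by rewrite !mulrA -rmorphM [_ * c k l ^+ _]mulrC.
have commk e r : x k ^+ e * iota r = iota r * x k ^+ e.
  exact/commr_sym/commrX/commr_sym/x_iota.
rewrite mulrA -[_ * x k ^+ be k]mulrA move_k -!mulrA (IHs (path_sorted ks)).
rewrite [_ ^+ be k * (_ * _)]mulrA commk mulrA commk -!mulrA; congr (_ * _).
by rewrite [LHS]mulrA commk -!mulrA.
Qed.

Lemma twistDr al : {morph twist al : be be' / be + be' >-> be * be'}.
Proof.
move=> be be'; rewrite /twist -big_split; apply: eq_bigr => k _ /=.
rewrite -big_split; apply: eq_bigr => l _ /=.
by rewrite ffunE -exprD -mulnDr.
Qed.

Lemma twist0r al : twist al 0 = 1.
Proof.
by rewrite /twist big1 // => k _; rewrite big1 // => l _; rewrite ffunE muln0.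
Qed.

Definition term (r : R) al : A := iota r * std_mon x al.

(** The scalar collects one twist for each pair of factors because twist is
    multiplicative in its second argument. *)
Lemma prod_terms m (r : 'I_m -> R) (ga : 'I_m -> {ffun 'I_n -> nat}) :
  \prod_(i < m) term (r i) (ga i) =
  term (\prod_(i < m) r i
        * \prod_(i < m) \prod_(j < m | (i < j)%N) twist (ga i) (ga j))
       (\sum_(i < m) ga i).
Proof.
elim: (index_enum _) (sorted_index_enum m) => [_|k s IHs ks].
  rewrite !big_nil /term mul1r rmorph1 mul1r /std_mon big1 // => i _.
  by rewrite ffunE.
rewrite prod_pairs_cons // !big_cons (IHs (path_sorted ks)) /term.
rewrite -(big_morph _ (twistDr _) (twist0r _)).
rewrite mulrA -[_ * _ * iota _]mulrA std_mon_iota mulrA -mulrA std_monM.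
rewrite mulrA -!rmorphM; congr (iota _ * _).
by rewrite -!mulrA; congr (_ * (_ * _)); rewrite mulrC.
Qed.

(** * Vanishing of the standard polynomial at roots of unity *)

Section Roots.
Variable N : nat.
Hypothesis c_root : forall k l : 'I_n, (k < l)%N -> c k l ^+ N = 1.

Definition eqmod_exp al be := forall k, al k = be k %[mod N].

Lemma twist_eqmod al al' be be' :
  eqmod_exp al al' -> eqmod_exp be be' -> twist al be = twist al' be'.
Proof.
move=> al_al' be_be'; apply: eq_bigr => k _; apply: eq_bigr => l lt_kl.
rewrite -(expr_mod _ (c_root lt_kl)) -modnMml -modnMmr al_al' be_be'.
by rewrite modnMml modnMmr expr_mod ?c_root.
Qed.

(** The coefficient in [prod_terms] depends on the order of the factors only
    through residues of exponents modulo N, so precomposing with the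
    transposition of k and l changes the sign of a summand and nothing else.
    Pairing even with odd permutations keeps the argument valid in
    characteristic 2. *)
Lemma standard_terms_eq0 m (r : 'I_m -> R) ga (k l : 'I_m) :
  k != l -> eqmod_exp (ga k) (ga l) ->
  \sum_(s : 'S_m) (-1) ^+ s * \prod_(i < m) term (r (s i)) (ga (s i)) = 0.
Proof.
move=> neq_kl ga_kl; pose t := tperm k l.
have oddMt s : (s * t)%g = ~~ s :> bool.
  by rewrite odd_permM odd_tperm neq_kl addbT.
have ga_t i : eqmod_exp (ga (t i)) (ga i).
  by move=> h; rewrite /t; case: tpermP => // -> //; rewrite ga_kl.
rewrite (bigID (@odd_perm _)) /=.
apply: canLR (subrK _) _; rewrite add0r -sumrN.
rewrite (reindex_inj (mulIg t)); apply: eq_big => //= s.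
rewrite oddMt => /negPf->; rewrite mulN1r mul1r; congr (- _).
rewrite !prod_terms; congr (term (_ * _) _).
- by transitivity (\prod_i r i);
    [rewrite [RHS](reindex_perm (s * t)%g) | rewrite [LHS](reindex_perm s)].
- apply: eq_bigr => i _; apply: eq_bigr => j _; rewrite !permM.
  exact: twist_eqmod.
- by transitivity (\sum_i ga i);
    [rewrite [RHS](reindex_perm (s * t)%g) | rewrite [LHS](reindex_perm s)].
Qed.

Hypothesis N_gt0 : (0 < N)%N.

Lemma pigeonhole_eqmod m (ga : 'I_m -> {ffun 'I_n -> nat}) :
  (N ^ n < m)%N -> exists k l, k != l /\ eqmod_exp (ga k) (ga l).
Proof.
move=> lt_m.
pose res i := [ffun h => Ordinal (ltn_pmod (ga i h) N_gt0)].
have : ~~ injectiveb res.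
  apply/negP => /injectiveP /leq_card.
  by rewrite card_ord card_ffun !card_ord leqNgt lt_m.
case/injectivePn => k [l neq_kl /ffunP res_kl]; exists k, l; split=> // h.
by have:= congr1 val (res_kl h); rewrite !ffunE.
Qed.

(** Writing all arguments over the common finite support D of their expansions
    turns multilinearity into one distribution of a product over sums. *)
Lemma standard_eq0 m (a : 'I_m -> A) : std_basis iota x -> (N ^ n < m)%N ->
  \sum_(s : 'S_m) (-1) ^+ s * \prod_(i < m) a (s i) = 0.
Proof.
move=> [spanA _] lt_m.
have /fin_all_exists[p def_a] : forall i, exists p, a i = std_comb iota x p.
  by move=> i; apply: spanA.
pose D := (\big[fsetU/fset0]_(i < m) msupp (p i))%fset.
have expand i : a i = \sum_(t : D) term ((p i)@_(val t)) (val t).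
  rewrite def_a /std_comb (mmapEw (d := D)) ?big_seq_fsetE //.
  apply/fsubsetP => al al_p; apply/bigfcupP; exists i => //;
    by rewrite ?mem_index_enum.
under eq_bigr => s _.
  under eq_bigr do rewrite expand.
  rewrite bigA_distr_bigA mulr_sumr.
  (* A choice of basis elements for the factors of the permuted product is
     reindexed as a choice for the arguments themselves, which makes the two
     summations independent. *)
  rewrite (reindex (fun h : {ffun 'I_m -> D} => [ffun i => h (s i)])) /=;
    last first.
    exists (fun h : {ffun 'I_m -> D} => [ffun i => h ((s^-1)%g i)]) => h _;
      by apply/ffunP => i; rewrite !ffunE ?permK ?permKV.
  under eq_bigr => h _.
    under eq_bigr => i _ do rewrite ffunE.
    over.
  over.
rewrite exchange_big big1 //= => h _.
have [k [l [neq_kl eq_kl]]] := pigeonhole_eqmod (fun i => val (h i)) lt_m.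
pose r i := (p i)@_(val (h i)).
exact: (@standard_terms_eq0 _ r (fun i => val (h i)) _ _ neq_kl eq_kl).
Qed.

End Roots.

(** * Substitution of probes *)

Section TwoVariables.
Variables i0 j0 : 'I_n.
Hypothesis lt_ij : (i0 < j0)%N.

Definition exps N p : {ffun 'I_n -> nat} :=
  [ffun k => if k == i0 then (2 * p)%N else if k == j0 then N else 0%N].

(** In the twist the only surviving pair of indices is (i0, j0). *)
Lemma twist_exps N p N' p' :
  twist (exps N p) (exps N' p') = c i0 j0 ^+ (N * (2 * p')).
Proof.
have neq_ji : j0 == i0 = false by apply: gtn_eqF.
rewrite /twist (bigD1 i0) //= [X in _ * X]big1 ?mulr1 => [|k neq_ki].
  rewrite (bigD1 j0) //= big1 ?mulr1 => [|l /andP[lt_il neq_lj]].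
    by rewrite !ffunE neq_ji !eqxx.
  have neq_li : l == i0 = false by apply: gtn_eqF.
  by rewrite !ffunE neq_li (negPf neq_lj) mul0n.
rewrite big1 // => l lt_kl; rewrite !ffunE (negPf neq_ki).
case: (k =P j0) => [def_k|_]; last by rewrite muln0.
rewrite def_k in lt_kl.
have neq_li : l == i0 = false by apply/gtn_eqF/(ltn_trans lt_ij).
have neq_lj : l == j0 = false by apply/gtn_eqF.
by rewrite neq_li neq_lj mul0n.
Qed.

Lemma exps_eq N p N' p' : (exps N p == exps N' p') = (N == N') && (p == p').
Proof.
have neq_ji : j0 == i0 = false by apply: gtn_eqF.
apply/eqP/andP => [/ffunP eq_exps | [/eqP-> /eqP->] //].
have := eq_exps j0; have := eq_exps i0; rewrite !ffunE !eqxx neq_ji => /eqP.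
by rewrite eqn_pmul2l // => -> /eqP.
Qed.

Local Notation q := (c i0 j0).

(** Multiplying h probes by the p-th one on their right costs q^(2 N p h),
    because of the exponent 2 p; the weight completes this to the square in
    [dist_energy], and d^2 keeps the weight nonnegative. *)
Definition probe N d p := term (q ^+ (N * (d ^ 2 - p ^ 2))) (exps N p).

Lemma prod_probe N d m (p : 'I_m -> nat) :
  \prod_(i < m) probe N d (p i) =
  term (q ^+ (N * energy d p)) (exps (N * m) (\sum_(i < m) p i)).
Proof.
rewrite prod_terms; congr (term _ _).
  under [X in _ * X]eq_bigr do under eq_bigr do rewrite twist_exps.
  rewrite prodrXr (exchange_big_dep xpredT) //=.
  under [X in _ * X]eq_bigr => j _.
    rewrite -(big_ord_widen m (fun=> q ^+ (N * (2 * p j)))) //;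
      last exact: ltnW.
    rewrite prodr_const card_ord -exprM; over.
  rewrite prodrXr -exprD /energy big_split mulnDr !big_distrr /=.
  congr (_ ^+ (_ + _)); apply: eq_bigr => i _; lia.
apply/ffunP => k; rewrite sum_ffunE ffunE.
under eq_bigr do rewrite ffunE.
case: (k == i0); first by rewrite big_distrr.
case: (k == j0); last by rewrite big1.
by rewrite sum_nat_const card_ord mulnC.
Qed.

Definition probe_at m (w0 : seq 'I_m) N (k : 'I_m) : A :=
  \sum_(p < size w0 | tnth (in_tuple w0) p == k) probe N (size w0) p.

Lemma word_probe_at m (w0 w : seq 'I_m) N :
  \prod_(k <- w) probe_at w0 N k =
  \sum_(p : {ffun 'I_(size w) -> 'I_(size w0)} | p \in family (matches w0 w))
    term (q ^+ (N * energy (size w0) (fun i => p i)))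
         (exps (N * size w) (\sum_(i < size w) p i)).
Proof.
rewrite big_tnth bigA_distr_big_dep; apply: eq_bigr => p _.
exact: prod_probe.
Qed.

Lemma root_energy_poly m (f : ncpoly m) w0 N : std_basis iota x ->
  (forall a : 'I_m -> A, nceval a f = 0) -> (0 < N)%N ->
  root (energy_poly R f w0) (q ^+ N).
Proof.
move=> [_ freeA] f0 N_gt0; set d := size w0.
pose P : {malg R[{ffun 'I_n -> nat}]} := \sum_(w <- msupp f)
  (\sum_(p : {ffun 'I_(size w) -> 'I_d} | p \in family (matches w0 w))
    << q ^+ (N * energy d (fun i => p i)) *g
       exps (N * size w) (\sum_(i < size w) p i)%N >>) *~ f@_w.
have P0 : P = 0.
  apply: freeA; rewrite -(f0 (probe_at w0 N)) /nceval mmapE /std_comb raddf_sum.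
  apply: eq_bigr => w _; rewrite word_probe_at mulrzl raddfMz raddf_sum /=.
  by congr (_ *~ _); apply: eq_bigr => p _; rewrite mmapU.
have := congr1 (mcoeff (exps (N * d) (\sum_(i < d) i)%N)) P0.
rewrite mcoeff0 raddf_sum => Pd0; apply/eqP; rewrite -[RHS]Pd0 /energy_poly.
rewrite -horner_evalE raddf_sum; apply: eq_bigr => w _ /=.
rewrite !raddfMz !raddf_sum /=; congr (_ *~ _).
rewrite big_mkcond [RHS]big_mkcond; apply: eq_bigr => p _ /=.
rewrite mcoeffU exps_eq eqn_pmul2l // /level_map.
case: (p \in family (matches w0 w)) => //=; case: (_ && _) => //.
by rewrite horner_evalE hornerXn exprM.
Qed.

End TwoVariables.
End QuantumMonomials.

(** * The characterization *)

Theorem theorem2p9 (R : idomainType) (A : nzRingType)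
    (iota : {rmorphism R -> A}) (n : nat) (x : 'I_n -> A)
    (c : 'I_n -> 'I_n -> R) :
  skew_PBW iota x ->
  semicommutative iota x ->
  (forall i j : 'I_n,
     c i j != 0 /\ x j * x i = iota (c i j) * x i * x j) ->
  PI_ring A <-> (forall i j : 'I_n, (i < j)%N -> is_unity_root (c i j)).
Proof.
move=> [_ basisA _ _] [_ [sigma [delta [maps const]]]] c_rel.
have x_iota i r : GRing.comm (x i) (iota r).
  have [_ _ x_r] := maps i; have [sigma_r delta_r] := const i r.
  by rewrite /GRing.comm x_r sigma_r delta_r rmorph0 addr0.
have x_swap i j : x j * x i = iota (c i j) * x i * x j by have [] := c_rel i j.
split=> [[m [f [[w0 f_w0 _] f0]]] i j lt_ij | c_root].
  have [c_neq0 _] := c_rel i j.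
  apply: (root_powers_unity c_neq0 (energy_poly_neq0 R f_w0)) => N.
  exact: root_energy_poly.
have [N N_gt0 cN1] :
    exists2 N, (0 < N)%N & forall k l : 'I_n, (k < l)%N -> c k l ^+ N = 1.
  have /fin_all_exists[N cN] : forall kl : 'I_n * 'I_n, exists N,
      (0 < N)%N /\ ((kl.1 < kl.2)%N -> c kl.1 kl.2 ^+ N = 1).
    case=> k l /=; case: (ltnP k l) => [/c_root[N N_gt0 cN]|_];
      last by exists 1%N.
    by exists N; split=> // _; apply/eqP; rewrite -unity_rootE.
  exists (\prod_kl N kl)%N => [|k l lt_kl].
    by apply: prodn_gt0 => kl; case: (cN kl).
  have [_ /(_ lt_kl) ckl] := cN (k, l).
  by rewrite (bigD1 (k, l)) //= exprM ckl expr1n.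
exists (N ^ n).+1, (standard_poly (N ^ n).+1); split=> [|a].
  exact: ncmonic_standard_poly.
rewrite nceval_standard_poly; exact: (standard_eq0 x_iota x_swap cN1 N_gt0).
Qed.
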